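(* Let $\lambda,\mu,\zeta,\sigma_z^2,P_T>0$ and $p_{ch}=\mathbb{Q}\big(\sqrt{\zeta P_T/\sigma_z^2}\big)$. Consider an error-correcting code with $k$ information bits and blocklength $n$, encoded on a circuit $\mathrm{EncCkt}$ implemented in Implementation Model $(\lambda,\mu)$, and transmitted over a channel with Channel Model $(\zeta,\sigma_z^2)$ (a binary symmetric channel with crossover probability $p_{ch}$), with block-error probability $P_e^{blk}$. Then the average number of bit-meters expended by the encoder satisfies $$\overline{\text{bit-meters}}(\mathrm{EncCkt})\ \ge\ \frac{k}{48\sqrt2}\sqrt{\frac{\log\frac{1}{10P_e^{blk}}}{\log\frac{1}{2p_{ch}}}}\;\lambda ,$$ as long as $$\log\frac{1}{10P_e^{blk}}>50\log\frac{1}{2p_{ch}},$$ for both fixed-message-length and flexible-message-length encoding.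
   Context: Channel Model $(\zeta,\sigma_z^2)$: $k$ i.i.d. fair bits $b_1,\dots,b_k$ are mapped by an encoder to a binary codeword $X_1^n\in\{0,1\}^n$, with rate $R=k/n$ assumed fixed. The codeword is sent by BPSK with transmit power $P_T$ over an AWGN channel with path loss $\zeta$ and noise variance $\sigma_z^2$, and the receiver makes a hard decision on each symbol. The resulting channel $X_1^n\to Y_1^n$ is a binary symmetric channel (without feedback) with crossover probability $p_{ch}=\mathbb{Q}(\sqrt{\zeta P_T/\sigma_z^2})$, where $\mathbb{Q}(x)=\int_x^\infty \frac{1}{\sqrt{2\pi}}e^{-t^2/2}dt$. The decoder computes $\hat b_1^k$ from $Y_1^n$ (here no implementation constraint is imposed on the decoder), and $P_e^{blk}=\Pr(\hat b_1^k\ne b_1^k)$. Implementation Model $(\lambda,\mu)$: The substrate is a square $\mathrm{Sq}(l)$ in $\mathbb{R}^2$ with vertices $(0,0),(0,l),(l,0),(l,l)$. A circuit $\mathrm{Ckt}=(\mathrm{Sq}(l),\mathcal S)$ is the substrate together with a set $\mathcal S$ of computational nodes, where $\mathcal S\subset \mathrm{Sq}(l)\cap\{(s\lambda,t\lambda):s,t\in\mathbb Z\}$. Nodes have finite storage memory and are input nodes (each stores one bit of the input of the computation at the start), output nodes (each stores one bit of the output at the end), or helper nodes. Between any ordered pair of nodes there is a noiseless unidirectional link, which may be used any number of times. Messages are binary strings. The order of the messages passed between nodes is predetermined, and each message is a function of all the messages (and the input bit, if any) received at the transmitting node until the start of the message's transmission. In a fixed-message-length computation the length of every message is predetermined (independent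 of the input). In a flexible-message-length computation the number of bits in a message may depend on the input of the computation, but each message has at least one bit. For an encoder circuit the $k$ input nodes (''bit-nodes'') store $b_1,\dots,b_k$ and the $n$ output nodes store the codeword symbols $X_1,\dots,X_n$ at the end. Bit-meters: the bit-meters of a link are the total number of bits carried by the messages on it during the computation times the Euclidean distance between its two end nodes. The bit-meters of a circuit are the sum over all links. The average bit-meters, $\overline{\text{bit-meters}}$, is the expectation over the uniformly distributed input $b_1^k$. The energy of the computation is $\mu$ times its bit-meters. *)

(* Defs.v *)
(* MathComp-Analysis, over an abstract [R : realType]. *)
From HB Require Import structures.
From mathcomp Require Import all_boot all_order all_algebra finmap.
From mathcomp Require Import all_classical all_reals all_analysis.

Set Implicit Arguments.
Unset Strict Implicit.
Unset Printing Implicit Defensive.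

Import Order.TTheory GRing.Theory Num.Theory.
Import numFieldNormedType.Exports.

Local Open Scope classical_set_scope.
Local Open Scope ring_scope.

Section Channel.
Context {R : realType}.

Definition Qfun (x : R) : R :=
  \int[lebesgue_measure]_(t in `[x, +oo[)
    ((Num.sqrt (2 * pi))^-1 * expR (- (t ^+ 2 / 2))).

(* BPSK at power [PT], path loss [zeta], noise variance [sigma2], followed by
   a hard decision on each symbol. *)
Definition crossover (zeta sigma2 PT : R) : R :=
  Qfun (Num.sqrt (zeta * PT / sigma2)).

Definition bsc (p : R) (n : nat) (x y : n.-tuple bool) : R :=
  \prod_(i < n) (if tnth y i == tnth x i then 1 - p else p).

(* Expectation under the uniform distribution of k i.i.d. fair bits. *)
Definition average (k : nat) (f : k.-tuple bool -> R) : R :=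
  (\sum_(b : k.-tuple bool) f b) / 2 ^+ k.

Definition block_error (p : R) (k n : nat)
    (enc : k.-tuple bool -> n.-tuple bool)
    (dec : n.-tuple bool -> k.-tuple bool) : R :=
  average (fun b => \sum_(y : n.-tuple bool | dec y != b) bsc p (enc b) y).

End Channel.

Section Implementation.
Context {R : realType}.

Definition square (l : R) : set (R * R) :=
  [set p | (0 <= p.1 <= l) /\ (0 <= p.2 <= l)].

Definition lattice (lambda : R) : set (R * R) :=
  [set p | exists s t : int, p = (s%:~R * lambda, t%:~R * lambda)].

(* Nodes are identified with their positions, so distinct nodes occupy
   distinct lattice points. *)
Record circuit (lambda : R) := Circuit {
  side : R;
  nodes : {fset R * R};
  side_gt0 : 0 < side;
  nodes_sub : [set` nodes] `<=` square side `&` lattice lambda }.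

Definition euclid (p q : R * R) : R :=
  Num.sqrt ((p.1 - q.1) ^+ 2 + (p.2 - q.2) ^+ 2).

(* What a node knows at some time: its input bit, if it is an input node, and
   the messages received so far, in order of arrival.  Since the schedule is
   predetermined, the sender of each of them need not be recorded. *)
Definition knowledge : Type := option bool * seq (seq bool).

Record message (N : Type) := Message {
  src : N;
  dst : N;
  content : knowledge -> seq bool }.

(* A computation with k input bits and n output bits.  [schedule] lists the
   messages by starting time; it does not depend on the input.  A node outside
   the ranges of [input_node] and [output_node] is a helper node; a node may
   serve both as an input and as an output node. *)
Record computation (lambda : R) (C : circuit lambda) (k n : nat) :=
  Computation {
    input_node : 'I_k -> nodes C;
    output_node : 'I_n -> nodes C;
    schedule : seq (message (nodes C));
    output_fun : 'I_n -> knowledge -> bool;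
    input_node_inj : injective input_node;
    output_node_inj : injective output_node }.

Section Run.
Variables (lambda : R) (C : circuit lambda) (k n : nat).
Variables (E : computation C k n) (b : k.-tuple bool).

Definition stored_bit (u : nodes C) : option bool :=
  omap (tnth b) [pick i | input_node E i == u].

(* Messages already sent, oldest first, each with its link (source, target). *)
Definition transcript : Type := seq ((nodes C * nodes C) * seq bool).

Definition know (l : transcript) (u : nodes C) : knowledge :=
  (stored_bit u, [seq m.2 | m <- l & m.1.2 == u]).

Definition send (l : transcript) (m : message (nodes C)) : transcript :=
  rcons l ((src m, dst m), content m (know l (src m))).

Definition run : transcript := foldl send [::] (schedule E).

Definition codeword : n.-tuple bool :=
  [tuple output_fun E j (know run (output_node E j)) | j < n].

Definition link_bits (u v : nodes C) : nat :=
  (\sum_(m <- run | m.1 == (u, v)) size m.2)%N.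

Definition bit_meters : R :=
  \sum_(u : nodes C) \sum_(v : nodes C)
    (link_bits u v)%:R * euclid (val u) (val v).

End Run.

Section Lengths.
Variables (lambda : R) (C : circuit lambda) (k n : nat).
Variable E : computation C k n.

Definition fixed_length : Prop :=
  exists lens : seq nat, forall b : k.-tuple bool,
    [seq size m.2 | m <- run E b] = lens.

Definition flexible_length : Prop :=
  forall b : k.-tuple bool, all (fun m => (0 < size m.2)%N) (run E b).

Definition average_bit_meters : R := average (bit_meters E).

End Lengths.
End Implementation.

(* Main.v *)
Require Import Defs.
From HB Require Import structures.
From mathcomp Require Import all_boot all_order all_algebra finmap.
From mathcomp Require Import all_classical all_reals all_analysis measurable_realfun.
From mathcomp Require Import ring lra zify.

(* Partition the lattice into s x s cells, with s the integer part of the square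
   root of log(1/(10 P_e)) / log(1/(2 p)).  Each noise factor of the channel is
   at least p = (2 p) (1/2), so up to a factor (2 p)^(s^2) >= 10 P_e the channel
   may be taken to erase all the outputs of a given cell; the remaining outputs
   then still determine the message with probability at least 9/10.  Given the
   inputs outside the cell, those outputs are a function of the messages leaving
   the cell.  Marking the last bit of every message turns these messages into a
   prefix code, so Kraft's inequality forces, on average, at least 2/5 of a bit
   out of the cell per input bit stored in it.

   Summing over the cells, and averaging over the s^2 translates of the
   partition, a link of length d is cut by a fraction at most
   sqrt 2 d / (s lambda) of the partitions, whence
   sqrt 2 * bit-meters >= (2/5) k s lambda. *)

Set Implicit Arguments.
Unset Strict Implicit.
Unset Printing Implicit Defensive.

Import Order.TTheory GRing.Theory Num.Theory.
Import numFieldNormedType.Exports.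

Local Open Scope ring_scope.

(** * Prefix coding of message sequences *)

(** The flag after each bit tells whether the word ends there, so concatenated nonempty words can be
    parsed; the price is a doubled length. *)
Fixpoint stop_flagged (w : seq bool) : seq bool :=
  if w is a :: w' then [:: a, nilp w' & stop_flagged w'] else [::].

Definition delimited (T : seq (seq bool)) : seq bool :=
  flatten (map stop_flagged T).

Lemma size_delimited T : size (delimited T) = (\sum_(w <- T) size w).*2.
Proof.
have szw w : size (stop_flagged w) = (size w).*2.
  by elim: w => //= a w ->; rewrite doubleS.
rewrite /delimited; elim: T => [|w T IH] /=; first by rewrite big_nil.
by rewrite size_cat big_cons IH szw doubleD.
Qed.

Lemma stop_flagged_cat_inj w w' r r' : nilp w = nilp w' ->
  stop_flagged w ++ r = stop_flagged w' ++ r' -> w = w' /\ r = r'.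
Proof.
elim: w w' => [|a w IH] [|a' w'] //= _ [-> nilww' /(IH _ nilww') [-> ->]].
by [].
Qed.

(* Empty words leave no trace in [delimited], so their positions must agree. *)
Lemma delimited_prefix_free T T' z : [seq nilp w | w <- T] = [seq nilp w | w <- T'] ->
  prefix (delimited T) z -> prefix (delimited T') z -> T = T'.
Proof.
move=> nilTT' /prefixP [r ->] /prefixP [r'].
elim: T T' nilTT' => [|w T IH] [|w' T'] //= [nilww' nilTT'].
rewrite /delimited /= -!catA => /(stop_flagged_cat_inj nilww') [-> /(IH _ nilTT') ->].
by [].
Qed.

Lemma card_prefix_tuple N (u : seq bool) : (size u <= N)%N ->
  (2 ^ (N - size u) <= #|[set z : N.-tuple bool | prefix u z]|)%N.
Proof.
move=> uN; have e : (size u + (N - size u) = N)%N by rewrite subnKC.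
pose f (v : (N - size u).-tuple bool) := tcast e (cat_tuple (in_tuple u) v).
have finj : injective f.
  move=> v v' /(congr1 (@tval _ _)); rewrite /f !val_tcast /= => /eqP.
  by rewrite eqseq_cat // eqxx /= => /eqP /val_inj.
rewrite -[X in (X ^ _)%N]card_bool -card_tuple -(card_imset _ finj).
apply/subset_leq_card/fintype.subsetP => _ /imsetP [v _ ->].
by rewrite inE /f val_tcast /= prefix_prefix.
Qed.

(** * Kraft's inequality and the length of a description of the cut *)

Section CutBound.
Variable R : realType.

(** For [L <= m] this is [1 + j <= 2 ^ j] with [j = m - L]; otherwise the left side is nonpositive.
    It serves to linearize the terms of a Kraft sum. *)
Lemma expn2_bernoulli m L : (1 + m%:R - L%:R : R) * 2 ^+ L <= 2 ^+ m.
Proof.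
have sucle j : (j.+1%:R : R) <= 2 ^+ j.
  by rewrite -natrX ler_nat ltn_expl.
have [Lm|mL] := leqP L m.
  rewrite -{2}(subnK Lm) exprD ler_wpM2r ?exprn_ge0 //.
  by rewrite (le_trans _ (sucle _)) // -natr1 natrB //; lra.
apply: (@le_trans _ _ 0); last by rewrite exprn_ge0.
rewrite mulr_le0_ge0 ?exprn_ge0 //.
have : (m.+1%:R : R) <= L%:R by rewrite ler_nat.
by rewrite -natr1; lra.
Qed.

Lemma sum_tuple_prod n (f : 'I_n -> bool -> R) :
  \sum_(y : n.-tuple bool) \prod_(i < n) f i (tnth y i) =
  \prod_(i < n) (f i true + f i false).
Proof.
transitivity (\prod_(i < n) \sum_(a : bool) f i a); last first.
  by apply: eq_bigr => i _; rewrite big_bool.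
rewrite bigA_distr_bigA /= (reindex (fun y : n.-tuple bool => [ffun i => tnth y i])) /=.
  by apply: eq_bigr => y _; apply: eq_bigr => i _; rewrite ffunE.
exists (fun h : {ffun 'I_n -> bool} => [tuple h i | i < n]) => [y _|h _].
  by apply: eq_from_tnth => i; rewrite tnth_mktuple ffunE.
by apply/ffunP => i; rewrite ffunE tnth_mktuple.
Qed.

(* [2 ^- size (g b)] is the fraction of the strings of a large length [N] that
   extend [g b], which avoids counting codewords by length. *)
Lemma kraft_groups (k : nat) (I : {set 'I_k}) (g : k.-tuple bool -> seq bool)
    (c : k.-tuple bool -> R) :
  (forall b, 0 <= c b) ->
  (forall z b0, \sum_(b | prefix (g b) z &&
       [forall i, (i \notin I) ==> (tnth b i == tnth b0 i)]) c b <= 1) ->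
  \sum_b c b / 2 ^+ size (g b) <= 2 ^+ (k - #|I|).
Proof.
move=> c0 c1; pose N := \max_b size (g b).
have gN b : (size (g b) <= N)%N by rewrite /N (leq_bigmax b).
pose out (b : k.-tuple bool) : {ffun {i : 'I_k | i \in ~: I} -> bool} :=
  [ffun i => tnth b (val i)].
have outE b b0 : (out b == out b0) =
    [forall i, (i \notin I) ==> (tnth b i == tnth b0 i)].
  apply/eqP/forallP => [/ffunP e i|e].
    apply/implyP => iI; have iI' : i \in ~: I by rewrite inE.
    by have := e (exist _ i iI'); rewrite !ffunE /= => ->.
  apply/ffunP => -[i iI]; rewrite !ffunE /=; apply/eqP; apply: (implyP (e i)).
  by move: iI; rewrite inE.
rewrite -(ler_pM2l (_ : 0 < 2 ^+ N :> R)) ?exprn_gt0 //.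
rewrite mulr_sumr.
apply: (@le_trans _ _ (\sum_b \sum_(z : N.-tuple bool | prefix (g b) z) c b)).
  apply: ler_sum => b _; rewrite sumr_const mulrCA -[X in _ <= X]mulr_natr.
  rewrite ler_wpM2l // -{1}(subnK (gN b)) exprD mulfK ?expf_neq0 //.
  rewrite -natrX ler_nat (leq_trans (card_prefix_tuple (gN b))) //.
  by apply/eq_leq/eq_card => z; rewrite !inE.
rewrite (exchange_big_dep predT) //=.
have -> : 2 ^+ N * 2 ^+ (k - #|I|) =
    \sum_(z : N.-tuple bool) (2 ^+ (k - #|I|) : R).
  by rewrite sumr_const card_tuple card_bool -[RHS]mulr_natl natrX.
apply: ler_sum => z _.
(* For a fixed [z], each of the [2 ^ (k - #|I|)] assignments of the bits outside [I] contributes at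
   most 1. *)
rewrite (partition_big out predT) //=.
apply: (@le_trans _ _ (\sum_(o : {ffun {i : 'I_k | i \in ~: I} -> bool}) 1)).
  apply: ler_sum => o _.
  case: (pickP [pred b | out b == o]) => /= [b0 b0o|none].
    have e b : prefix (g b) z && (out b == o) = prefix (g b) z &&
        [forall i, (i \notin I) ==> (tnth b i == tnth b0 i)].
      by rewrite -(eqP b0o) outE.
    by rewrite (eq_bigl _ _ e).
  by rewrite big_pred0 // => b; have /= -> := none b; rewrite andbF.
rewrite sumr_const card_ffun card_bool card_sig.
rewrite -natrX ler_nat leq_exp2l //.
by rewrite cardsCs finset.setCK card_ord.
Qed.

(** Replacing the outputs in [J] by fair coin flips keeps the mean error at most 1/10. Messages that
    agree outside [I] and whose codes are prefixes of one string then have the same output law, so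
    their success probabilities sum to at most 1, and Kraft's inequality weighted by these
    probabilities applies. *)
Lemma cut_information_bound (p : R) (k n : nat)
    (enc : k.-tuple bool -> n.-tuple bool) (dec : n.-tuple bool -> k.-tuple bool)
    (I : {set 'I_k}) (J : {set 'I_n}) (g : k.-tuple bool -> seq bool) :
  0 < p -> p <= 1 / 2 ->
  (forall b b' z, (forall i, i \notin I -> tnth b i = tnth b' i) ->
     prefix (g b) z -> prefix (g b') z ->
     forall j, j \notin J -> tnth (enc b) j = tnth (enc b') j) ->
  10 * block_error p enc dec <= (2 * p) ^+ #|J| ->
  4 / 5 * #|I|%:R * 2 ^+ k <= \sum_b (size (g b))%:R :> R.
Proof.
move=> p0 p12 det err.
have [->|I0] := posnP #|I|.
  by rewrite mulr0 mul0r sumr_ge0.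
have K0 : 0 < 2 ^+ k :> R by rewrite exprn_gt0.
pose w (x a : bool) : R := if a == x then 1 - p else p.
pose q b (y : n.-tuple bool) : R :=
  \prod_(j < n) (if j \in J then 1 / 2 else w (tnth (enc b) j) (tnth y j)).
have w0 x a : 0 <= w x a by rewrite /w; case: ifP => _; lra.
have q0 b y : 0 <= q b y.
  by apply: prodr_ge0 => j _; case: ifP => _ //; lra.
have q1 b : \sum_y q b y = 1.
  rewrite /q (sum_tuple_prod
    (fun j a => if j \in J then 1 / 2 else w (tnth (enc b) j) a)).
  rewrite big1 // => j _; case: ifP => _; first lra.
  by rewrite /w; case: (tnth _ _) => /=; lra.
have qbsc b y : (2 * p) ^+ #|J| * q b y <= bsc p (enc b) y.
  rewrite /q /bsc -prodr_const [X in X * _]big_mkcond /= -big_split /=.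
  apply: ler_prod => j _; case: ifP => jJ; last by rewrite mul1r w0 lexx.
  by case: ifP => _; apply/andP; split; lra.
pose e b := \sum_(y | dec y != b) q b y.
pose c b := \sum_(y | dec y == b) q b y.
have ce b : c b = 1 - e b.
  by rewrite -(q1 b) (bigID (fun y => dec y == b)) /= addrK.
have e0 b : 0 <= e b by rewrite sumr_ge0.
have c0 b : 0 <= c b by rewrite sumr_ge0.
have esum : \sum_b e b <= 2 ^+ k / 10.
  have J0 : 0 < (2 * p) ^+ #|J| by rewrite exprn_gt0 // mulr_gt0.
  rewrite -(ler_pM2l J0).
  have : (2 * p) ^+ #|J| * \sum_b e b <= 2 ^+ k * block_error p enc dec.
    rewrite /block_error /average mulrCA divff ?gt_eqF // mulr1.
    rewrite mulr_sumr; apply: ler_sum => b _; rewrite mulr_sumr.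
    by apply: ler_sum => y _; exact: qbsc.
  move=> /le_trans; apply.
  set P := block_error _ _ _ in err *; set J' := _ ^+ #|J| in err *.
  by move: (2 ^+ k) K0 => K K0; nra.
have kraft : \sum_b c b / 2 ^+ size (g b) <= 2 ^+ (k - #|I|).
  apply: kraft_groups => // z b0.
  pose P := [pred b | prefix (g b) z &&
    [forall i, (i \notin I) ==> (tnth b i == tnth b0 i)]].
  rewrite -[leLHS]/(\sum_(b | P b) c b).
  have [b1 Pb1|none] := pickP P; last by rewrite big_pred0.
  have qE b : P b -> q b =1 q b1.
    move=> Pb y; apply: eq_bigr => j _; case: ifP => // /negbT jJ.
    move: Pb Pb1 => /andP [gb /forallP bb0] /andP [gb1 /forallP b1b0].
    rewrite (det b b1 z) // => i iI.
    by rewrite (eqP (implyP (bb0 i) iI)) (eqP (implyP (b1b0 i) iI)).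
  (* The events [dec y == b] are disjoint and are all measured by the one law [q b1], of total mass
     1. *)
  rewrite -(q1 b1) (partition_big dec predT) //= [X in _ <= X](bigID P) /=.
  rewrite -[X in X <= _]addr0 lerD //; last first.
    by rewrite sumr_ge0 // => b _; rewrite sumr_ge0.
  by apply: ler_sum => b Pb; rewrite /c; apply: ler_sum => y _; rewrite qE.
have Ik : (#|I| <= k)%N by rewrite -[X in (_ <= X)%N]card_ord max_card.
have key : (1 + #|I|%:R) * (\sum_b c b) - \sum_b (size (g b))%:R <= 2 ^+ k.
  have -> : 2 ^+ k = 2 ^+ (k - #|I|) * 2 ^+ #|I| :> R by rewrite -exprD subnK.
  apply: le_trans (_ : (\sum_b c b / 2 ^+ size (g b)) * 2 ^+ #|I| <= _); last first.
    by rewrite ler_wpM2r // exprn_ge0.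
  rewrite mulr_sumr mulr_suml -sumrB; apply: ler_sum => b _.
  have c1 : c b <= 1 by rewrite ce; move: (e0 b); lra.
  (* Since [c b <= 1], weighting the length by [c b] only decreases it. *)
  apply: (@le_trans _ _ (c b * (1 + #|I|%:R - (size (g b))%:R))).
    have : 0 <= (size (g b))%:R :> R by [].
    by move: c1 (c0 b); nra.
  rewrite -mulrA ler_wpM2l // mulrC ler_pdivlMr ?exprn_gt0 //.
  exact: expn2_bernoulli.
have cs : \sum_b c b = 2 ^+ k - \sum_b e b.
  under eq_bigr do rewrite ce.
  by rewrite sumrB sumr_const card_tuple card_bool -natrX.
have I1 : 1 <= #|I|%:R :> R by rewrite ler1n.
(* The success probabilities total at least 9/10 of [2 ^ k], so the mean length is at least
   [9/10 * (1 + #|I|) - 1], which is at least [4/5 * #|I|] because [#|I| >= 1]. *)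
move: key; rewrite cs; set s := \sum_b _ %:R; set ee := \sum_b e b in esum *.
move: (2 ^+ k) K0 esum I1 => K K0; nra.
Qed.

End CutBound.

(** * Messages crossing a cut of the circuit *)

Section Cut.
Variables (R : realType) (lambda : R) (C : circuit lambda) (k n : nat).
Variable E : computation C k n.

Definition cut_content (S : {set nodes C}) (l : transcript C) : seq (seq bool) :=
  [seq m.2 | m <- l & (m.1.1 \in S) && (m.1.2 \notin S)].

(** Induction on the schedule: a message sent from outside [S] is the same in both runs by
    induction, one staying inside [S] is not seen outside, and one leaving [S] is part of the cut
    content. *)
Lemma cut_content_determines (S : {set nodes C}) (b b' : k.-tuple bool) :
  (forall i, input_node E i \notin S -> tnth b i = tnth b' i) ->
  cut_content S (run E b) = cut_content S (run E b') ->
  forall u, u \notin S -> know E b (run E b) u = know E b' (run E b') u.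
Proof.
move=> bb'; rewrite /run.
have stored u : u \notin S -> stored_bit E b u = stored_bit E b' u.
  rewrite /stored_bit; case: pickP => //= i /eqP <- iS.
  by rewrite bb'.
elim/last_ind: (schedule E) => [_ u uS|s m IH]; first by rewrite /know stored.
rewrite !foldl_rcons; set l := foldl _ _ s in IH *; set l' := foldl _ _ s in IH *.
rewrite /send /cut_content !filter_rcons /=.
have knowE u v b0 l0 c : know E b0 (rcons l0 ((u, v), c)) =1
    fun w => let K := know E b0 l0 w in if v == w then (K.1, rcons K.2 c) else K.
  by move=> w; rewrite /know filter_rcons /=; case: ifP; rewrite ?map_rcons.
have [srcS|srcS] := boolP (src m \in S); last first.
  by move=> /IH {}IH u uS; rewrite !knowE (IH _ srcS) (IH u uS).
have [dstS|dstS] /= := boolP (dst m \in S).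
  move=> /IH {}IH u uS; rewrite !knowE (IH u uS); case: eqP => // e.
  by rewrite -e dstS in uS.
rewrite !map_rcons => /rcons_inj [/IH {}IH /= ->] u uS.
by rewrite !knowE IH.
Qed.

Lemma run_links (b b' : k.-tuple bool) :
  [seq m.1 | m <- run E b] = [seq m.1 | m <- run E b'].
Proof.
rewrite /run; elim/last_ind: (schedule E) => // s m IH.
by rewrite !foldl_rcons /send !map_rcons IH.
Qed.

(** With fixed lengths the same messages are empty in every run; with flexible lengths none is. This
    is what makes [delimited] prefix-free across inputs. *)
Lemma cut_content_nilp (S : {set nodes C}) (b b' : k.-tuple bool) :
  fixed_length E \/ flexible_length E ->
  [seq nilp w | w <- cut_content S (run E b)] =
  [seq nilp w | w <- cut_content S (run E b')].
Proof.
move=> lengths.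
have empties : [seq nilp m.2 | m <- run E b] = [seq nilp m.2 | m <- run E b'].
  case: lengths => [[lens lensE]|pos].
    have nilE (l : transcript C) :
        [seq nilp m.2 | m <- l] = [seq j == 0%N | j <- [seq size m.2 | m <- l]].
      by rewrite -map_comp; apply: eq_map => m; rewrite /nilp.
    by rewrite !nilE !lensE.
  have nilE b0 : [seq nilp m.2 | m <- run E b0] =
      nseq (size [seq m.1 | m <- run E b0]) false.
    have := pos b0; elim: (run E b0) => //= m l IH /andP [m0 /IH ->].
    by congr cons; apply/negbTE; rewrite /nilp -lt0n.
  by rewrite !nilE (run_links b b').
move: (run_links b b') empties; rewrite /cut_content.
elim: (run E b) (run E b') => [|m l IH] [|m' l'] //= [mm' ll'] [nilm nill].
by rewrite -mm'; case: ifP => _ /=; rewrite ?nilm (IH l').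
Qed.

(** A message between two colors leaves exactly one color class, that of its source. *)
Lemma sum_bits_cut (T : finType) (color : nodes C -> T) (b : k.-tuple bool) :
  (\sum_(t : T) \sum_(w <- cut_content [set u | color u == t] (run E b)) size w =
   \sum_(m <- run E b | color m.1.1 != color m.1.2) size m.2)%N.
Proof.
under eq_bigr => t _ do rewrite /cut_content big_map big_filter big_mkcond /=.
rewrite exchange_big /= [RHS]big_mkcond /=; apply: eq_bigr => m _.
rewrite (bigD1 (color m.1.1)) //= !inE eqxx /= [(color m.1.2 == _)]eq_sym.
rewrite big1 ?addn0 //= => t /negbTE tm.
by rewrite !inE [color m.1.1 == t]eq_sym tm.
Qed.

Lemma bit_metersE (b : k.-tuple bool) :
  bit_meters E b = \sum_(m <- run E b)
    (size m.2)%:R * euclid (val m.1.1) (val m.1.2).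
Proof.
rewrite /bit_meters /link_bits.
under eq_bigr => u _ do under eq_bigr => v _ do
  rewrite natr_sum big_mkcond mulr_suml.
under eq_bigr => u _ do rewrite exchange_big.
rewrite exchange_big /=; apply: eq_bigr => -[[u v] c] _ /=.
rewrite (bigD1 u) //= (bigD1 v) //= eqxx [X in _ + X + _]big1 ?addr0.
  rewrite [X in _ + X]big1 ?addr0 // => u' /negbTE uu'.
  by rewrite big1 // => v' _; rewrite xpair_eqE [u == u']eq_sym uu' mul0r.
by move=> v' /negbTE vv'; rewrite xpair_eqE eqxx [v == v']eq_sym vv' mul0r.
Qed.

(** The square lies in the first quadrant, so natural numbers suffice, and cells can be given by
    [%/]. *)
Lemma lattice_coordinates : 0 < lambda ->
  exists x y : nodes C -> nat,
    forall u, val u = ((x u)%:R * lambda, (y u)%:R * lambda).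
Proof.
move=> lambda0.
have coord (u : nodes C) : exists xy : nat * nat,
    val u = (xy.1%:R * lambda, xy.2%:R * lambda).
  have [[/andP [x0 _] /andP [y0 _]] [s [t e]]] := nodes_sub (valP u).
  move: x0 y0; rewrite e /= !pmulr_lge0 // !ler0z => s0 t0.
  by exists (`|s|%N, `|t|%N); rewrite /= !natr_absz !ger0_norm.
have [xy xyE] := choice coord.
by exists (fun u => (xy u).1), (fun u => (xy u).2).
Qed.

End Cut.

(** * Shifted grids and lattice distances *)

(** Passing from [x] to [x + 1] trades the term [x %/ s] for [(x + s) %/ s], which is larger by
    one. *)
Lemma hermite_identity s x : (0 < s)%N -> (\sum_(i < s) (x + i) %/ s = x)%N.
Proof.
move=> s0; elim: x => [|x IH].
  by rewrite big1 // => i _; rewrite add0n divn_small.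
case: s s0 IH => // s _ IH.
rewrite big_ord_recr /= addSnnS divnDr // divnn /= addnA addn1.
move: IH; rewrite big_ord_recl addn0 => e; rewrite -[in RHS]e addnC.
by congr (_ + _).+1; apply: eq_bigr => i _; rewrite addSnnS.
Qed.

(** Each separating shift makes the two quotients differ by at least 1, and by Hermite's identity
    the differences total the distance, written here with truncated subtractions. *)
Lemma separating_shifts s x x' : (0 < s)%N ->
  (\sum_(i < s) ((x + i) %/ s != (x' + i) %/ s)%N <= (x - x') + (x' - x))%N.
Proof.
move=> s0; wlog le : x x' / (x <= x')%N => [hw|].
  have [/hw //|/ltnW /hw le] := leqP x x'.
  rewrite addnC (leq_trans _ le) //.
  by apply: leq_sum => i _; rewrite eq_sym.
rewrite (eqP le) add0n -{2}(hermite_identity x s0) -{2}(hermite_identity x' s0).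
rewrite leq_subRL; last by apply: leq_sum => i _; rewrite leq_div2r // leq_add2r.
rewrite -big_split /=; apply: leq_sum => i _.
have : ((x + i) %/ s <= (x' + i) %/ s)%N by rewrite leq_div2r // leq_add2r.
by case: eqP => [->|] /=; lia.
Qed.

(** Within a cell, the residues of the coordinates modulo [s] determine the point. *)
Lemma leq_card_cell (T : finType) (x y : T -> nat) s (A : {set T}) a c :
  (0 < s)%N -> (forall u v, x u = x v -> y u = y v -> u = v) ->
  (forall u, u \in A -> (x u %/ s)%N = a /\ (y u %/ s)%N = c) ->
  (#|A| <= s ^ 2)%N.
Proof.
case: s => // s _ xy_inj cell.
pose r u : 'I_s.+1 * 'I_s.+1 := (inord (x u %% s.+1), inord (y u %% s.+1)).
have rinj : {in A &, injective r}.
  move=> u v uA vA [] /(congr1 val) + /(congr1 val).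
  rewrite /= !inordK ?ltn_mod // => xuv yuv.
  have [[xu yu] [xv yv]] := (cell u uA, cell v vA).
  by apply: xy_inj; [rewrite (divn_eq (x u) s.+1) (divn_eq (x v) s.+1) xu xv xuv
    |rewrite (divn_eq (y u) s.+1) (divn_eq (y v) s.+1) yu yv yuv].
rewrite -(card_in_imset rinj) (leq_trans (max_card _)) //.
by rewrite card_prod !card_ord.
Qed.

(** For the coordinate distances [u] and [v], the inequality is
    [(u + v) ^ 2 <= 2 * (u ^ 2 + v ^ 2)], that is, [0 <= (u - v) ^ 2]. *)
Lemma manhattan_euclid (R : realType) (lambda : R) (a b a' b' : nat) :
  0 < lambda ->
  ((a - a') + (a' - a) + ((b - b') + (b' - b)))%:R * lambda <=
  Num.sqrt 2 * euclid (a%:R * lambda, b%:R * lambda) (a'%:R * lambda, b'%:R * lambda).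
Proof.
move=> lambda0; rewrite /euclid /=.
have distE (c d : nat) : ((c - d) + (d - c))%:R = `|c%:R - d%:R| :> R.
  have [le|/ltnW le] := leqP c d.
    by rewrite (eqP le) add0n natrB // distrC ger0_norm // subr_ge0 ler_nat.
  by rewrite (eqP le) addn0 natrB // ger0_norm // subr_ge0 ler_nat.
rewrite natrD !distE -!mulrBl !exprMn -mulrDl -sqrtrM // mulrA sqrtrM; last first.
  by rewrite mulr_ge0 // addr_ge0 ?sqr_ge0.
rewrite [Num.sqrt (lambda ^+ 2)]sqrtr_sqr (gtr0_norm lambda0) ler_wpM2r ?(ltW lambda0) //.
rewrite -[leLHS]ger0_norm ?addr_ge0 // -sqrtr_sqr ler_wsqrtr //.
rewrite -[(a%:R - _) ^+ 2]real_normK ?num_real //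
  -[(b%:R - _) ^+ 2]real_normK ?num_real //.
set u := `|_|; set v := `|_|; have := sqr_ge0 (u - v); lra.
Qed.

(** * The Gaussian tail *)

Lemma Qfun_ge0 (R : realType) (x : R) : 0 <= Qfun x.
Proof.
by apply: Rintegral_ge0 => t _; rewrite mulr_ge0 ?invr_ge0 ?sqrtr_ge0 ?expR_ge0.
Qed.

(** The standard normal density is even, so the positive half-line has mass 1/2, and it contains the
    ray from [x]. *)
Lemma Qfun_le_half (R : realType) (x : R) : 0 <= x -> Qfun x <= 1 / 2.
Proof.
move=> x0; pose mu := @lebesgue_measure R; pose f := @normal_pdf R 0 1.
have fE t : f t = (Num.sqrt (2 * pi))^-1 * expR (- (t ^+ 2 / 2)).
  rewrite /f normal_pdfE ?oner_neq0 // /normal_peak /normal_fun.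
  by rewrite subr0 expr1n mul1r mulNr [2 * pi]mulr_natl.
have f0 t : 0 <= f t by exact: normal_pdf_ge0.
have half : (\int[mu]_(t in `[0%R, +oo[) (f t)%:E = (1 / 2)%:E)%E.
  have := @integral_normal_pdf R 0 1.
  rewrite (@ge0_symfun_integralT _ f) //; last 2 first.
  - by apply: continuous_normal_pdf; rewrite oner_neq0.
  - by move=> t; rewrite /= !fE sqrrN.
  rewrite (_ : [set t | _] = `[0, +oo[%classic)%classic; last first.
    by apply/seteqP; split => t /=; rewrite in_itv /= andbT.
  case: (integral _ _ _) => [r| |] //.
    by rewrite -EFinM => -[] e; congr EFin; lra.
  by rewrite gt0_muley.
  by rewrite gt0_muleNy.
rewrite /Qfun /Rintegral.
have le : (\int[mu]_(t in `[x, +oo[) (f t)%:E <= (1 / 2)%:E)%E.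
  rewrite -half; apply: ge0_subset_integral => //.
  - by apply/measurable_EFinP/measurable_funTS; exact: measurable_normal_pdf.
  - by move=> t _; rewrite lee_fin.
  - by apply: subset_itvr; rewrite bnd_simp.
(* Together with [le] this makes the integral finite, so its real value is faithful. *)
have ge : (0 <= \int[mu]_(t in `[x, +oo[) (f t)%:E)%E.
  by apply: integral_ge0 => t _; rewrite lee_fin.
under eq_integral do rewrite -fE.
by move: le ge; rewrite /mu; case: (integral _ _ _) => [r| |].
Qed.

(** * Cut bounds for cells, averaged over grid shifts *)

Section Grid.
Variables (R : realType) (lambda : R) (C : circuit lambda) (k n : nat).
Variables (E : computation C k n) (dec : n.-tuple bool -> k.-tuple bool) (p : R).
Hypothesis lengths : fixed_length E \/ flexible_length E.
Hypotheses (p_gt0 : 0 < p) (p_le_half : p <= 1 / 2).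

(** Outputs sit at distinct nodes, so at most [N] of them are in [S], and [2 * p <= 1] transfers the
    error bound to their number. Delimiting doubles the bits, which turns 4/5 into 2/5. *)
Lemma node_set_cut_bound (S : {set nodes C}) (N : nat) : (#|S| <= N)%N ->
  10 * block_error p (codeword E) dec <= (2 * p) ^+ N ->
  2 / 5 * #|[set i | input_node E i \in S]|%:R * 2 ^+ k <=
  \sum_b (\sum_(w <- cut_content S (run E b)) size w)%:R :> R.
Proof.
have p2_ge0 : 0 <= 2 * p by rewrite mulr_ge0 ?ltW.
have p2_le1 : 2 * p <= 1 by move: p_le_half; lra.
move=> SN err; set I := [set i | _].
pose J := [set j | output_node E j \in S].
pose g b := delimited (cut_content S (run E b)).
have JS : (#|J| <= #|S|)%N.
  rewrite -(card_imset _ (@output_node_inj _ _ _ _ _ E)) subset_leq_card //.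
  by apply/fintype.subsetP => _ /imsetP [j + ->]; rewrite inE.
have errJ : 10 * block_error p (codeword E) dec <= (2 * p) ^+ #|J|.
  by rewrite (le_trans err) // ler_wiXn2l ?(leq_trans JS) // ?p2_ge0 // p2_le1.
have := @cut_information_bound R p k n (codeword E) dec I J g p_gt0 p_le_half _ errJ.
under eq_bigr => b _ do rewrite size_delimited -muln2 natrM.
rewrite -mulr_suml => bound.
suff /bound : forall b b' z,
    (forall i, i \notin I -> tnth b i = tnth b' i) ->
    prefix (g b) z -> prefix (g b') z ->
    forall j, j \notin J -> tnth (codeword E b) j = tnth (codeword E b') j.
  clear; move: (\sum_b _) (2 ^+ k) (#|I|%:R) => B K m; nra.
move=> b b' z bb' gb gb' j; rewrite inE !tnth_mktuple => jS; congr output_fun.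
apply: (@cut_content_determines _ _ _ _ _ E S) => //.
  by move=> i iS; apply: bb'; rewrite inE.
exact: delimited_prefix_free (cut_content_nilp S b b' lengths) gb gb'.
Qed.

(** Each input node has one color and each crossing message leaves one class, so the bounds of the
    classes add up. *)
Lemma coloring_cut_bound (T : finType) (color : nodes C -> T) (N : nat) :
  (forall t, #|[set u | color u == t]| <= N)%N ->
  10 * block_error p (codeword E) dec <= (2 * p) ^+ N ->
  2 / 5 * k%:R * 2 ^+ k <=
  \sum_b (\sum_(m <- run E b | color m.1.1 != color m.1.2) size m.2)%:R :> R.
Proof.
move=> colorN err.
have kE : k%:R = \sum_t
    #|[set i | input_node E i \in [set u | color u == t]]|%:R :> R.
  rewrite -natr_sum -[in LHS](card_ord k) -sum1_card.
  rewrite (partition_big (color \o input_node E) predT) //=.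
  congr _%:R; apply: eq_bigr => t _; rewrite sum1_card.
  by apply: eq_card => i; rewrite !inE.
rewrite kE mulr_sumr mulr_suml.
under [leRHS]eq_bigr => b _ do rewrite -sum_bits_cut natr_sum.
rewrite exchange_big /=; apply: ler_sum => t _.
exact: node_set_cut_bound (colorN t) err.
Qed.

(** The cut bound is summed over [s ^ 2] shifts, while a message over Manhattan distance [d] is cut
    by at most [s * d] of them; one factor [s] survives. *)
Lemma grid_bound (s : nat) : 0 < lambda -> (0 < s)%N ->
  10 * block_error p (codeword E) dec <= (2 * p) ^+ (s ^ 2) ->
  2 / 5 * k%:R * s%:R * lambda <= Num.sqrt 2 * average_bit_meters E.
Proof.
move=> lambda0 s0 err.
have [x [y xyE]] := lattice_coordinates C lambda0.
have K0 : 0 < 2 ^+ k :> R by rewrite exprn_gt0.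
have S0 : 0 < s%:R :> R by rewrite ltr0n.
pose cell (i j : 'I_s) u := (((x u + i) %/ s)%N, ((y u + j) %/ s)%N).
(* A cell is coded by the set of nodes in it, so that colors form a finite type. *)
pose color i j u := [set v | cell i j v == cell i j u].
have xy_inj u v : x u = x v -> y u = y v -> u = v.
  by move=> xuv yuv; apply: val_inj; rewrite !xyE xuv yuv.
have color_card i j t : (#|[set u | color i j u == t]| <= s ^ 2)%N.
  have [->|[u0]] := set_0Vmem [set u | color i j u == t]; first by rewrite cards0.
  rewrite inE => /eqP <-.
  apply: (@leq_card_cell _ (fun u => x u + i) (fun u => y u + j) _ _
    (cell i j u0).1 (cell i j u0).2)%N => // [u v /addIn xuv /addIn yuv|u].
    exact: xy_inj.
  rewrite inE => /eqP colu.
  have : u \in color i j u by rewrite inE.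
  by rewrite colu inE => /eqP <-.
pose d (m : (nodes C * nodes C) * seq bool) : nat :=
  ((x m.1.1 - x m.1.2) + (x m.1.2 - x m.1.1) +
   ((y m.1.1 - y m.1.2) + (y m.1.2 - y m.1.1)))%N.
(* Different colors force different quotients in some coordinate. Each coordinate involves only one
   of the two shifts; the other is free, whence the factor [s]. *)
have separated m : (\sum_(i < s) \sum_(j < s)
    (color i j m.1.1 != color i j m.1.2) <= s * d m)%N.
  apply: (@leq_trans (\sum_(i < s) \sum_(j < s)
      (((x m.1.1 + i) %/ s != (x m.1.2 + i) %/ s) +
       ((y m.1.1 + j) %/ s != (y m.1.2 + j) %/ s)))%N).
    apply: leq_sum => i _; apply: leq_sum => j _.
    case: eqP => // colne; case: eqP => xe; case: eqP => ye //.
    by case: colne; rewrite /color /cell xe ye.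
  under eq_bigr => i _ do rewrite big_split /= sum_nat_const card_ord.
  rewrite big_split /= -big_distrr /= sum_nat_const card_ord -mulnDr leq_mul2l.
  by rewrite leq_add ?orbT ?separating_shifts.
have bound : \sum_(i < s) \sum_(j < s) (2 / 5 * k%:R * 2 ^+ k : R) <=
    \sum_b \sum_(m <- run E b) (size m.2 * (s * d m))%:R.
  apply: (@le_trans _ _ (\sum_(i < s) \sum_(j < s) \sum_b
      (\sum_(m <- run E b | color i j m.1.1 != color i j m.1.2) size m.2)%:R)).
    apply: ler_sum => i _; apply: ler_sum => j _.
    exact: coloring_cut_bound (color_card i j) err.
  under eq_bigr => i _ do rewrite exchange_big /=.
  rewrite exchange_big /=; apply: ler_sum => b _.
  under eq_bigr => i _ do rewrite -natr_sum.
  rewrite -!natr_sum ler_nat.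
  under eq_bigr => i _.
    under eq_bigr => j _ do rewrite big_mkcond /=.
    rewrite exchange_big /=; over.
  rewrite exchange_big /=; apply: leq_sum => m _.
  rewrite (leq_trans _ (leq_mul (leqnn _) (separated m))) // big_distrr /=.
  apply: leq_sum => i _; rewrite big_distrr /=; apply: leq_sum => j _.
  by case: ifP; rewrite ?muln1 ?muln0.
have dist m : (d m)%:R * lambda <=
    Num.sqrt 2 * euclid (val m.1.1) (val m.1.2).
  by rewrite !xyE manhattan_euclid.
move: bound; rewrite !sumr_const !card_ord -[_ *+ _ *+ _]mulr_natr
  -[X in X * s%:R]mulr_natr => bound.
rewrite /average_bit_meters /average mulrA ler_pdivlMr // -(ler_pM2l S0).
apply: (@le_trans _ _ ((\sum_b \sum_(m <- run E b) (size m.2 * (s * d m))%:R) * lambda)).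
  rewrite [leLHS](_ : _ = 2 / 5 * k%:R * 2 ^+ k * s%:R * s%:R * lambda); last by ring.
  by rewrite ler_wpM2r ?(ltW lambda0).
rewrite mulrA !mulr_sumr mulr_suml; apply: ler_sum => b _.
rewrite bit_metersE mulr_suml mulr_sumr; apply: ler_sum => m _.
by rewrite !natrM -!mulrA mulrCA ler_wpM2l // [leRHS]mulrCA ler_wpM2l.
Qed.

Lemma average_bit_meters_ge0 : 0 <= average_bit_meters E.
Proof.
rewrite divr_ge0 ?exprn_ge0 // sumr_ge0 // => b _.
apply: sumr_ge0 => u _; apply: sumr_ge0 => v _.
by rewrite mulr_ge0 // sqrtr_ge0.
Qed.

End Grid.

(** * Choice of the cell side and conclusion *)

Theorem theorem2 (R : realType) (lambda mu zeta sigma2 PT : R)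
    (lambda_gt0 : 0 < lambda) (mu_gt0 : 0 < mu) (zeta_gt0 : 0 < zeta)
    (sigma2_gt0 : 0 < sigma2) (PT_gt0 : 0 < PT)
    (k n : nat) (C : circuit lambda) (EncCkt : computation C k n)
    (dec : n.-tuple bool -> k.-tuple bool)
    (lengths : fixed_length EncCkt \/ flexible_length EncCkt) :
  let p_ch := crossover zeta sigma2 PT in
  let P_e := block_error p_ch (codeword EncCkt) dec in
  ln (1 / (10 * P_e)) > 50 * ln (1 / (2 * p_ch)) ->
  average_bit_meters EncCkt >=
    k%:R / (48 * Num.sqrt 2)
    * Num.sqrt (ln (1 / (10 * P_e)) / ln (1 / (2 * p_ch))) * lambda.
Proof.
move=> p_ch P_e; set A := 1 / (10 * P_e); set B := 1 / (2 * p_ch) => lnAB.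
(* Division by zero yields 0, so the claimed bound is then 0. *)
have [lnB0|lnB_neq0] := eqVneq (ln B) 0.
  by rewrite lnB0 invr0 mulr0 sqrtr0 mulr0 mul0r average_bit_meters_ge0.
have p_ge0 : 0 <= p_ch by exact: Qfun_ge0.
have p_le : p_ch <= 1 / 2 by apply: Qfun_le_half; exact: sqrtr_ge0.
(* If [p_ch = 0] then [B = 1 / 0 = 0] and [ln B = 0]. *)
have p_gt0 : 0 < p_ch.
  rewrite lt0r p_ge0 andbT; apply: contraNneq lnB_neq0 => p0.
  by rewrite /B p0 mulr0 invr0 mulr0 ln0.
have B_ge1 : 1 <= B by rewrite /B ler_pdivlMr ?mulr_gt0 //; lra.
have B_gt0 : 0 < B by exact: lt_le_trans ltr01 B_ge1.
have lnB_gt0 : 0 < ln B by rewrite lt0r lnB_neq0 ln_ge0.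
have lnA_gt0 : 0 < ln A by apply: lt_trans lnAB; rewrite mulr_gt0.
(* As [ln] vanishes on nonpositive reals, [ln A > 0] also rules out [P_e = 0], where [A] would be
   0. *)
have A_gt0 : 0 < A.
  by rewrite ltNge; apply: contraTN lnA_gt0 => /ln0 ->; rewrite ltxx.
set r := ln A / ln B.
have r_gt50 : 50 < r by rewrite ltr_pdivlMr.
have sqr_r : Num.sqrt r ^+ 2 = r by rewrite sqr_sqrtr //; lra.
have sqrt_r_ge1 : 1 <= Num.sqrt r.
  by rewrite -[leLHS]sqrtr1 ler_wsqrtr //; lra.
(* The largest side with [s ^ 2 <= r], that is, with [B ^ (s ^ 2) <= A]. *)
pose s := Num.truncn (Num.sqrt r).
have s_le : s%:R <= Num.sqrt r by rewrite truncn_le sqrtr_ge0.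
have s_gt : Num.sqrt r < s%:R + 1 by rewrite natr1 truncnS_gt.
have s_gt0 : (0 < s)%N by rewrite truncn_gt0.
have s_ge1 : 1 <= s%:R :> R by rewrite ler1n.
have err : 10 * P_e <= (2 * p_ch) ^+ (s ^ 2).
  have BA : B ^+ (s ^ 2) <= A.
    rewrite -ler_ln ?posrE ?exprn_gt0 // lnXn //.
    by rewrite -mulr_natl -ler_pdivlMr // natrX -/r -sqr_r ler_sqr ?nnegrE // sqrtr_ge0.
  have -> : 10 * P_e = A^-1 by rewrite /A div1r invrK.
  have -> : (2 * p_ch) ^+ (s ^ 2) = (B ^+ (s ^ 2))^-1.
    by rewrite /B div1r exprVn invrK.
  by rewrite lef_pV2 ?posrE ?exprn_gt0.
have := grid_bound lengths p_gt0 p_le lambda_gt0 s_gt0 err.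
set bm := average_bit_meters _ => bound.
have sqrt2_gt0 : 0 < Num.sqrt 2 :> R by rewrite sqrtr_gt0.
rewrite invfM mulrA -(ler_pM2l sqrt2_gt0).
apply: le_trans bound.
rewrite [leLHS](_ : _ = k%:R / 48 * Num.sqrt r * lambda); last by field; rewrite gt_eqF.
rewrite ler_wpM2r ?(ltW lambda_gt0) //.
rewrite [leRHS](_ : _ = k%:R * (2 / 5 * s%:R)); last by ring.
rewrite -mulrA ler_wpM2l //.
(* Rounding costs at most a factor 2: [q < s' + 1 <= 2 * s'], so [q / 48 <= s' / 24], which is below
   [2/5 * s']. *)
move: s_gt s_ge1 sqrt_r_ge1; clear; move: (s%:R) (Num.sqrt r) => s' q; lra.
Qed.
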